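(* Let $\nu\in\mathbb{N}\cup\{\infty\}$. 1. The operator $\Box$ maps the space of functions $\mathbf{u}:\mathbb{R}\to\mathbb{C}^d$ of piecewise-$\mathcal{C}^\nu$ regularity to the space of compactly supported functions $\mathbf{v}:\mathbb{R}\to\mathbb{C}^d$ of piecewise-$\mathcal{C}^\nu$ regularity such that $\mathrm{Supp}(\mathbf{v})\subset[t_0-N\varepsilon,t_f+N\varepsilon]$. 2. If $\mathbf{u}:\mathbb{R}\to\mathbb{C}^d$ has $p$ points of discontinuity on $\mathbb{R}$, then $\Box\mathbf{u}$ has at most $(4N+2)+(2N+1)p$ points of discontinuity on $\mathbb{R}$. 3. If $c_N$ or $c_{-N}$ is invertible, then the kernel of $\Box$ (acting on functions $\mathbb{R}\to\mathbb{C}^d$) consists of the functions which vanish on $[t_0,t_f]$. 4. If $c_N$ or $c_{-N}$ is invertible then, for all $\mathbf{u}:\mathbb{R}\to\mathbb{C}^d$, $\Box\mathbf{u}$ is measurable (respectively integrable, of piecewise-$\mathcal{C}^\nu$ regularity) on $\mathbb{R}$ if and only if $\mathbf{u}$ is measurable (respectively integrable, of piecewise-$\mathcal{C}^\nu$ regularity) on $[t_0,t_f]$.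
   Context: Let $[t_0,t_f]\subset\mathbb{R}$ be a fixed segment with characteristic function $\chi$, let $\varepsilon>0$ be a fixed time delay and let $d\ge 1$. Let $(c_k)_{k\in\mathbb{Z}}$ be an almost zero (i.e. finitely supported, not identically zero) sequence of matrices in $\mathbb{C}^{d\times d}$, and let $N$ be the largest integer such that $c_N\neq0$ or $c_{-N}\neq 0$. For $\mathbf{u}:\mathbb{R}\to\mathbb{C}^d$ the function $\Box\mathbf{u}:\mathbb{R}\to\mathbb{C}^d$ is defined by $$\Box\mathbf{u}(t)=\sum_{k\in\mathbb{Z}}c_k\,\mathbf{u}(t+k\varepsilon)\,\chi(t+k\varepsilon),\qquad t\in\mathbb{R}.$$ *)

(* Defs.v *)
From HB Require Import structures.
From mathcomp Require Import all_boot all_order all_algebra.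
From mathcomp Require Import all_classical all_reals all_analysis.
From mathcomp Require Import complex.
Set Implicit Arguments.
Unset Strict Implicit.
Unset Printing Implicit Defensive.
Import Order.TTheory GRing.Theory Num.Theory.
Import numFieldNormedType.Exports.
Local Open Scope classical_set_scope.
Local Open Scope ring_scope.
Local Open Scope complex_scope.

(* The field of complex numbers over [R] carries the topology of its modulus;
   the library provides it only on the alias [R[i]^o].  The spaces
   ['cV[R[i]]_d] then get the product topology. *)
#[non_forgetful_inheritance]
HB.instance Definition _ (R : realType) := PseudoPointedMetric.copy R[i] R[i]^o.

Definition almost_zero (R : realType) (d : nat) (c : int -> 'M[R[i]]_d) : Prop :=
  finite_set [set k | c k != 0] /\ exists k, c k != 0.

(* The largest such integer is necessarily nonnegative, by the symmetry
   k <-> -k, hence [N : nat]. *)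
Definition is_order (R : realType) (d : nat) (c : int -> 'M[R[i]]_d) (N : nat)
    : Prop :=
  (c N%:Z != 0 \/ c (- N%:Z) != 0) /\
  forall m : int, c m != 0 \/ c (- m) != 0 -> m <= N%:Z.

Definition box (R : realType) (d : nat) (t0 tf eps : R) (c : int -> 'M[R[i]]_d)
    (u : R -> 'cV[R[i]]_d) : R -> 'cV[R[i]]_d := fun t =>
  \sum_(k \in [set: int])
     \1_(`[t0, tf]%classic : set R) (t + k%:~R * eps) *:
       (c k *m u (t + k%:~R * eps)).

(* [g] has derivative [l] at [t] relatively to [A]: a one-sided derivative when
   [A] is a segment and [t] one of its endpoints. *)
Definition is_derive_within (R : realType) (d : nat) (A : set R)
    (g : R -> 'cV[R[i]]_d) (t : R) (l : 'cV[R[i]]_d) : Prop :=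
  ((s - t)^-1)%:C *: (g s - g t) @[s --> within (A `\ t) (nbhs t)] --> l.

Fixpoint Cn_on (R : realType) (d : nat) (A : set R) (n : nat)
    (g : R -> 'cV[R[i]]_d) : Prop :=
  if n is m.+1 then
    exists2 g' : R -> 'cV[R[i]]_d,
      (forall t, A t -> is_derive_within A g t (g' t)) & Cn_on A m g'
  else {within A, continuous g}.

(* Regularity orders: [Some n] is the natural number n, [None] is infinity. *)
Definition C_on (R : realType) (d : nat) (A : set R) (nu : option nat)
    (g : R -> 'cV[R[i]]_d) : Prop :=
  if nu is Some n then Cn_on A n g else forall n, Cn_on A n g.

(* There is a finite subdivision a = x_0 < ... < x_m = b such that the
   restriction of [u] to each ]x_i, x_(i+1)[ extends to a function of class
   C^nu on [x_i, x_(i+1)]; the values at the x_i are unconstrained. *)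
Definition piecewise_C_on (R : realType) (d : nat) (nu : option nat) (a b : R)
    (u : R -> 'cV[R[i]]_d) : Prop :=
  exists2 s : seq R, itv_partition a b s &
    forall i, (i < size s)%N ->
      exists2 g : R -> 'cV[R[i]]_d,
        C_on `[nth b (a :: s) i, nth b s i]%classic nu g &
        {in `]nth b (a :: s) i, nth b s i[, u =1 g}.

Definition piecewise_C (R : realType) (d : nat) (nu : option nat)
    (u : R -> 'cV[R[i]]_d) : Prop :=
  forall a b : R, a < b -> piecewise_C_on nu a b u.

Definition Supp (R : realType) (d : nat) (v : R -> 'cV[R[i]]_d) : set R :=
  closure [set t | v t != 0].

Definition discontinuities (R : realType) (d : nat) (u : R -> 'cV[R[i]]_d)
    : set R :=
  [set t | ~ {for t, continuous u}].

(* [R] with the sigma-algebra of Lebesgue measurable sets, the domain of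
   [completed_lebesgue_measure]. *)
Definition lebesgueT (R : realType) :=
  caratheodory_type
    (lebesgue_stieltjes_measure.wlength (idfun : R -> R))^*%mu.

(* Measurability and integrability of a vector-valued function are those of the
   real and imaginary parts of its coordinates. *)
Definition vmeasurable (R : realType) (d : nat) (A : set R)
    (u : R -> 'cV[R[i]]_d) : Prop :=
  forall i : 'I_d,
    measurable_fun (A : set (lebesgueT R)) (fun t => complex.Re (u t i 0)) /\
    measurable_fun (A : set (lebesgueT R)) (fun t => complex.Im (u t i 0)).

Definition vintegrable (R : realType) (d : nat) (A : set R)
    (u : R -> 'cV[R[i]]_d) : Prop :=
  forall i : 'I_d,
    (@completed_lebesgue_measure R).-integrable A
      (fun t => (complex.Re (u t i 0))%:E) /\
    (@completed_lebesgue_measure R).-integrable A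
      (fun t => (complex.Im (u t i 0))%:E).

(* Main.v *)
(* Cut off to the segment, [u] becomes a function [f] on the line, and [box u]
   is a finite combination of translates of [f] with matrix coefficients.  Every
   regularity class at hand is closed under such combinations.  When an extreme
   coefficient is invertible, [f] is zero beyond one end of the segment, so the
   relation [w = box u] can be solved for [f] step by step of length [eps] from
   that end; after finitely many steps [f] is, on the whole segment, a finite
   combination of translates of [w].  Thus the inverse of [box] is an operator
   of the same kind as [box], which gives the kernel and the equivalences. *)
Require Import Defs.
From mathcomp Require Import all_boot all_order all_algebra.
From mathcomp Require Import all_classical all_reals all_analysis.
From mathcomp Require Import complex.
From mathcomp Require Import measurable_realfun lra zify.
Set Implicit Arguments.
Unset Strict Implicit.
Unset Printing Implicit Defensive.
Import Order.TTheory GRing.Theory Num.Theory.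
Import numFieldNormedType.Exports.
Local Open Scope classical_set_scope.
Local Open Scope card_scope.
Local Open Scope ring_scope.
Local Open Scope complex_scope.

(** * Functions of class C^nu on a set *)

(** Neighbourhoods of a matrix are generated by families of neighbourhoods of its entries. One
    direction puts no condition on the other entries; the other intersects finitely many entry
    conditions. *)
Lemma cvg_mxP (K : topologicalType) (T : Type) (F : set_system T)
    (FF : Filter F) m n (f : T -> 'M[K]_(m, n)) (M : 'M[K]_(m, n)) :
  f @ F --> M <-> forall i j, (fun x => f x i j) @ F --> M i j.
Proof.
split=> [fM i j P nP|fM P [Q nQ QP]].
  have nQ : nbhs M [set N : 'M[K]_(m, n) | P (N i j)].
    exists (fun i' j' => [set z | i' = i -> j' = j -> P z]).
      move=> i' j'; have [[-> ->]|nij] := pselect (i' = i /\ j' = j).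
        by move: nP; apply: filterS => z Pz.
      by apply: filterE => z ? ?; case: nij.
    by move=> N /= /(_ i j); apply.
  exact: fM nQ.
suff H : \forall x \near F, forall ij : 'I_m * 'I_n,
    Q ij.1 ij.2 (f x ij.1 ij.2).
  rewrite nbhs_filterE; apply: filterS H => x Qx; apply: QP => i j.
  exact: (Qx (i, j)).
by apply: filter_forall => -[i j]; exact: (fM i j _ (nQ i j)).
Qed.

Section vector_limits.
Variables (R : realType) (T : Type) (F : set_system T).
Context {FF : Filter F}.
Variable d : nat.
Implicit Types (f g : T -> 'cV[R[i]]_d) (l k : 'cV[R[i]]_d).

Lemma cvg_vecD f g l k :
  f @ F --> l -> g @ F --> k -> (fun x => f x + g x) @ F --> l + k.
Proof.
move=> /cvg_mxP fl /cvg_mxP gk; apply/cvg_mxP => i j; rewrite mxE.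
under eq_fun do rewrite mxE.
(* The limit laws are taken in [R[i]^o], whose topology [R[i]] copies. *)
exact: (@cvgD R[i] R[i]^o _ F FF _ _ _ _ (fl i j) (gk i j)).
Qed.

Lemma cvg_vec_mulmx (A : 'M[R[i]]_d) f l :
  f @ F --> l -> (fun x => A *m f x) @ F --> A *m l.
Proof.
move=> /cvg_mxP fl; apply/cvg_mxP => i j; rewrite mxE.
under eq_fun do rewrite mxE.
elim: (index_enum _) => [|k r IH].
  rewrite (_ : (fun x => \sum_(k <- [::]) A i k * f x k j) = cst 0).
    by rewrite big_nil; exact: cvg_cst.
  by apply/funext => x; rewrite big_nil.
rewrite (_ : (fun x => \sum_(k <- k :: r) A i k * f x k j) =
  fun x => A i k * f x k j + \sum_(k <- r) A i k * f x k j); last first.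
  by apply/funext => x; rewrite big_cons.
rewrite big_cons; apply: (@cvgD R[i] R[i]^o _ F FF _ _ _ _ _ IH).
exact: (@cvgM R[i] _ F FF _ _ _ _ (cvg_cst _) (fl k j)).
Qed.

End vector_limits.

Section Cn_closure.
Variables (R : realType) (d : nat).
Implicit Types (A B : set R) (f g : R -> 'cV[R[i]]_d) (h : R) (n : nat).

Lemma is_derive_withinS A B g t l : B `<=` A ->
  is_derive_within A g t l -> is_derive_within B g t l.
Proof.
move=> BA dg P /dg; apply: (@filterS _ (nbhs t)) => s AP [Bs st].
by apply: AP; split => //; exact: BA.
Qed.

Lemma Cn_onS A B n g : B `<=` A -> Cn_on A n g -> Cn_on B n g.
Proof.
move=> BA; elim: n g => [|n IH] g /=.
  move=> /subspace_continuousP cg; apply/subspace_continuousP => x Bx P.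
  by move=> /(cg x (BA _ Bx)); apply: (@filterS _ (nbhs x)) => s AP /BA.
move=> [g' dg cg']; exists g'; last exact: IH.
by move=> t /BA /dg; exact: is_derive_withinS.
Qed.

Lemma Cn_on0 A n : Cn_on A n (fun=> 0 : 'cV[R[i]]_d).
Proof.
elim: n => [|n IH] /=; first by move=> x; exact: cvg_cst.
exists (fun=> 0) => // t _; rewrite /is_derive_within.
under eq_fun do rewrite subrr scaler0.
exact: cvg_cst.
Qed.

Lemma Cn_onD A n f g :
  Cn_on A n f -> Cn_on A n g -> Cn_on A n (fun t => f t + g t).
Proof.
elim: n f g => [|n IH] f g /=.
  move=> /subspace_continuousP cf /subspace_continuousP cg.
  apply/subspace_continuousP => x Ax.
  by apply: cvg_vecD; [exact: cf|exact: cg].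
move=> [f' df cf'] [g' dg cg'].
exists (fun t => f' t + g' t) => [t At|]; last exact: IH.
rewrite /is_derive_within.
under eq_fun do rewrite opprD addrACA scalerDr.
by apply: cvg_vecD; [exact: df|exact: dg].
Qed.

Lemma Cn_on_mulmx A n (M : 'M[R[i]]_d) g :
  Cn_on A n g -> Cn_on A n (fun t => M *m g t).
Proof.
elim: n g => [|n IH] g /=.
  move=> /subspace_continuousP cg; apply/subspace_continuousP => x Ax.
  by apply: cvg_vec_mulmx; exact: cg.
move=> [g' dg cg']; exists (fun t => M *m g' t) => [t At|]; last exact: IH.
rewrite /is_derive_within.
under eq_fun do rewrite -mulmxBr scalemxAr.
by apply: cvg_vec_mulmx; exact: dg.
Qed.

Lemma within_translate A h (t : R) :
  (s + h) @[s --> within ((fun x => x + h) @^-1` A) (nbhs t)]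
  `=>` within A (nbhs (t + h)).
Proof.
move=> P AP; have : (s + h) @[s --> t] --> t + h.
  by apply: cvgD => //; exact: cvg_cst.
by move=> /(_ _ AP).
Qed.

Lemma Cn_on_translate A n g h :
  Cn_on A n g -> Cn_on ((fun x => x + h) @^-1` A) n (fun t => g (t + h)).
Proof.
elim: n g => [|n IH] g /=.
  move=> /subspace_continuousP cg; apply/subspace_continuousP => x Ax P.
  move=> /(cg _ Ax).
  exact: within_translate.
move=> [g' dg cg']; exists (fun t => g' (t + h)) => [t At|]; last exact: IH.
move=> P /(dg _ At) nP.
(* Used for [A] deprived of [t + h], whose preimage is the preimage of [A] deprived of [t]; the
   difference quotients agree. *)
have := within_translate nP.
apply: (@filterS _ (nbhs t)) => s /= + [As /eqP st].
rewrite opprD addrACA subrr addr0.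
by apply; split => //; apply/eqP; apply: contra st => /eqP/addIr ->.
Qed.

Lemma C_onS A B nu g : B `<=` A -> C_on A nu g -> C_on B nu g.
Proof.
by case: nu => [n|] BA /= => [|Cg n]; [|move: (Cg n)]; exact: Cn_onS.
Qed.

Lemma C_on0 A nu : C_on A nu (fun=> 0 : 'cV[R[i]]_d).
Proof. by case: nu => [n|] /= => [|n]; exact: Cn_on0. Qed.

Lemma C_onD A nu f g :
  C_on A nu f -> C_on A nu g -> C_on A nu (fun t => f t + g t).
Proof.
case: nu => [n|] /=; first exact: Cn_onD.
by move=> Cf Cg n; exact: Cn_onD.
Qed.

Lemma C_on_mulmx A nu (M : 'M[R[i]]_d) g :
  C_on A nu g -> C_on A nu (fun t => M *m g t).
Proof.
by case: nu => [n|] /=; [exact: Cn_on_mulmx|move=> Cg n; exact: Cn_on_mulmx].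
Qed.

Lemma C_on_translate A nu g h :
  C_on A nu g -> C_on ((fun x => x + h) @^-1` A) nu (fun t => g (t + h)).
Proof.
case: nu => [n|] /=; first exact: Cn_on_translate.
by move=> Cg n; exact: Cn_on_translate.
Qed.

End Cn_closure.

(** * Translation invariance of the completed Lebesgue measure *)

(** The integral of [|f \o phi|] is that of [|f|] against the pushforward of [mu] by [phi], which
    coincides with [mu]. *)
Lemma integrable_measure_preserving d (T : measurableType d) (R : realType)
    (mu : {measure set T -> \bar R}) (phi : T -> T)
    (mphi : measurable_fun setT phi) (f : T -> \bar R) :
  (forall A, measurable A -> mu (phi @^-1` A) = mu A) ->
  mu.-integrable setT f -> mu.-integrable setT (f \o phi).
Proof.
move=> muphi /integrableP[mf fi]; apply/integrableP; split.
  exact: measurableT_comp.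
have maf : measurable_fun setT (abse \o f) by exact: measurableT_comp.
have <- : (\int[pushforward mu phi]_x (abse \o f) x =
           \int[mu]_x `|(f \o phi) x|)%E.
  exact: (ge0_integral_pushforward mphi mu measurableT maf
    (fun x _ => abse_ge0 (f x))).
by rewrite (eq_measure_integral mu)// => A mA _; exact: muphi.
Qed.

Section lebesgue_translation.
Variable R : realType.
Local Open Scope ereal_scope.

(** The Lebesgue outer measure, whose Caratheodory sets are the measurable sets of [lebesgueT R].
    Invariance is proved for lengths of half-open intervals, then for [outer], then for
    measurability. *)
Let outer := (lebesgue_stieltjes_measure.wlength (idfun : R -> R))^*%mu.

Let translate (h : R) : R -> R := fun x => (x + h)%R.

Let translateK h (A : set R) : translate h @^-1` (translate (- h) @^-1` A) = A.
Proof. by apply/seteqP; split=> x /=; rewrite /translate addrK. Qed.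

Let wlength_translate h (A : set R) : ocitv A ->
  ocitv (translate h @^-1` A) /\
  lebesgue_stieltjes_measure.wlength idfun (translate h @^-1` A) =
  lebesgue_stieltjes_measure.wlength idfun A :> \bar R.
Proof.
move=> [[a b] _ <-] /=.
have -> : translate h @^-1` `]a, b]%classic = `](a - h)%R, (b - h)%R]%classic.
  by apply/seteqP; split=> x /=; rewrite !in_itv/= ltrBlDr lerBrDr.
split; first exact: is_ocitv.
rewrite !wlength_itv/= !lte_fin ltrD2r/= !EFinN -!EFinD.
by rewrite opprD addrACA subrr addr0.
Qed.

(** Translating a countable cover of [A] by half-open intervals gives a cover of the translate with
    the same total length. *)
Let outer_translate_le h (A : set R) : outer (translate h @^-1` A) <= outer A.
Proof.
apply: le_ereal_inf_tmp => _ [B [mB AB] <-].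
apply: ereal_inf_lbound; exists (fun k => translate h @^-1` B k).
  split=> [k|x Ax]; first exact: (wlength_translate h (mB k)).1.
  by have [k _ Bx] := AB _ Ax; exists k.
apply: eq_eseriesr => k _; exact: (wlength_translate h (mB k)).2.
Qed.

Let outer_translate h (A : set R) : outer (translate h @^-1` A) = outer A.
Proof.
apply/eqP; rewrite eq_le outer_translate_le/=.
(* The reverse inequality comes from translating back by [- h]. *)
rewrite -[leLHS](_ : outer (translate (- h) @^-1` (translate h @^-1` A)) = _).
  exact: outer_translate_le.
by congr outer; have := translateK (- h) A; rewrite opprK.
Qed.

(** By invariance of [outer], the Caratheodory criterion for the translate of [A] tested on [X] is
    the criterion for [A] tested on a translate of [X]. *)
Lemma measurable_translate h :
  measurable_fun setT ((fun x => (x + h)%R) : lebesgueT R -> lebesgueT R).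
Proof.
move=> _ A mA; rewrite setTI.
change (outer.-caratheodory ((fun x : R => (x + h)%R) @^-1` A)).
have {}mA : outer.-caratheodory A := mA.
move=> X.
rewrite -(outer_translate (- h) X) -(outer_translate (- h) (X `&` (_ @^-1` A))).
rewrite -(outer_translate (- h) (X `&` ~` _)) !preimage_setI -preimage_setC.
have -> : translate (- h) @^-1` ((fun x => (x + h)%R) @^-1` A) = A.
  by apply/seteqP; split=> x /=; rewrite /translate subrK.
exact: mA.
Qed.

Lemma integrable_translate h (f : R -> \bar R) :
  (@completed_lebesgue_measure R).-integrable setT f ->
  (@completed_lebesgue_measure R).-integrable setT (fun x => f (x + h)%R).
Proof.
apply: (@integrable_measure_preserving _ _ _ (@completed_lebesgue_measure R) _
  (measurable_translate h)).
(* The completed measure of a set is its outer measure by definition. *)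
by move=> A _; exact: outer_translate.
Qed.

End lebesgue_translation.

(** * Measurability and integrability of vector-valued functions *)

Section vector_valued.
Variables (R : realType) (d : nat).
Implicit Types (u v : R -> 'cV[R[i]]_d) (M : 'M[R[i]]_d) (h : R).

Lemma ReD (x y : R[i]) : complex.Re (x + y) = complex.Re x + complex.Re y.
Proof. by case: x y => [? ?] []. Qed.

Lemma ImD (x y : R[i]) : complex.Im (x + y) = complex.Im x + complex.Im y.
Proof. by case: x y => [? ?] []. Qed.

Lemma Re_mulmx M (x : 'cV[R[i]]_d) i : complex.Re ((M *m x) i 0) =
  \sum_j (complex.Re (M i j) * complex.Re (x j 0) -
          complex.Im (M i j) * complex.Im (x j 0)).
Proof.
rewrite mxE; elim/big_rec2: _ => //= j y z _ <-; rewrite ReD; congr +%R.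
by case: (M i j) (x j 0) => [? ?] [].
Qed.

Lemma Im_mulmx M (x : 'cV[R[i]]_d) i : complex.Im ((M *m x) i 0) =
  \sum_j (complex.Re (M i j) * complex.Im (x j 0) +
          complex.Im (M i j) * complex.Re (x j 0)).
Proof.
rewrite mxE; elim/big_rec2: _ => //= j y z _ <-; rewrite ImD; congr +%R.
by case: (M i j) (x j 0) => [? ?] [].
Qed.

(** First of the three closure properties (zero, sums, matrix multiples of translates) that
    [comb_closed] requires; the same triple is proved for [vintegrable] and [piecewise_C]. *)
Lemma vmeasurable0 : vmeasurable setT (fun=> 0 : 'cV[R[i]]_d).
Proof.
by move=> i; split; under eq_fun do rewrite mxE; exact: measurable_cst.
Qed.

Lemma vmeasurableD u v : vmeasurable setT u -> vmeasurable setT v ->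
  vmeasurable setT (fun t => u t + v t).
Proof.
move=> mu mv i; split.
  under eq_fun do rewrite mxE ReD.
  by apply: measurable_funD; [exact: (mu i).1|exact: (mv i).1].
under eq_fun do rewrite mxE ImD.
by apply: measurable_funD; [exact: (mu i).2|exact: (mv i).2].
Qed.

Lemma vmeasurable_mulmx_translate M h u : vmeasurable setT u ->
  vmeasurable setT (fun t => M *m u (t + h)).
Proof.
move=> mu.
have mRe j : measurable_fun setT
    ((fun t => complex.Re (u (t + h) j 0)) : lebesgueT R -> R).
  exact: (measurableT_comp (mu j).1 (measurable_translate h)).
have mIm j : measurable_fun setT
    ((fun t => complex.Im (u (t + h) j 0)) : lebesgueT R -> R).
  exact: (measurableT_comp (mu j).2 (measurable_translate h)).
move=> i; split.
  under eq_fun do rewrite Re_mulmx.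
  apply: measurable_sum => j; apply: measurable_funB;
    by apply: measurable_funM => //; exact: measurable_cst.
under eq_fun do rewrite Im_mulmx.
apply: measurable_sum => j; apply: measurable_funD;
  by apply: measurable_funM => //; exact: measurable_cst.
Qed.

Local Notation mu := (@completed_lebesgue_measure R).

Lemma vintegrable0 : vintegrable setT (fun=> 0 : 'cV[R[i]]_d).
Proof. by move=> i; split; under eq_fun do rewrite mxE; exact: integrable0. Qed.

Lemma vintegrableD u v : vintegrable setT u -> vintegrable setT v ->
  vintegrable setT (fun t => u t + v t).
Proof.
move=> iu iv i; split.
  under eq_fun do rewrite mxE ReD EFinD.
  by apply: integrableD => //; [exact: (iu i).1|exact: (iv i).1].
under eq_fun do rewrite mxE ImD EFinD.
by apply: integrableD => //; [exact: (iu i).2|exact: (iv i).2].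
Qed.

Lemma vintegrable_mulmx_translate M h u : vintegrable setT u ->
  vintegrable setT (fun t => M *m u (t + h)).
Proof.
move=> iu.
have iRe j : mu.-integrable setT (fun t => (complex.Re (u (t + h) j 0))%:E).
  exact: (@integrable_translate _ h
    (fun t => (complex.Re (u t j 0))%:E) (iu j).1).
have iIm j : mu.-integrable setT (fun t => (complex.Im (u (t + h) j 0))%:E).
  exact: (@integrable_translate _ h
    (fun t => (complex.Im (u t j 0))%:E) (iu j).2).
move=> i; split.
  under eq_fun do rewrite Re_mulmx -sumEFin.
  apply: integrable_sum => // j _; under eq_fun do rewrite EFinB !EFinM.
  by apply: integrableB => //; exact: integrableZl.
under eq_fun do rewrite Im_mulmx -sumEFin.
apply: integrable_sum => // j _; under eq_fun do rewrite EFinD !EFinM.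
by apply: integrableD => //; exact: integrableZl.
Qed.

End vector_valued.

(** * Piecewise regularity *)

Section pieces.
Variables (R : realType) (d : nat) (nu : option nat).
Implicit Types (F : seq R) (a b h : R) (u v : R -> 'cV[R[i]]_d).

(* A subdivision-free form of [piecewise_C_on]: common refinements of
   subdivisions become concatenations of the exceptional lists [F]. *)
Definition pieces F a b u := forall x y, a <= x -> x < y -> y <= b ->
  (forall z, z \in F -> ~~ (x < z < y)) ->
  exists2 g, C_on `[x, y]%classic nu g & {in `]x, y[, u =1 g}.

(** Walk along the subdivision: if the first node [z] is at most [x], go on from [z]; otherwise [z],
    not being inside []x, y[], is at least [y], and the first cell works. *)
Lemma itv_partition_cover a b s x y : itv_partition a b s ->
  a <= x -> x < y -> y <= b -> (forall z, z \in s -> ~~ (x < z < y)) ->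
  exists2 i, (i < size s)%N & nth b (a :: s) i <= x /\ y <= nth b s i.
Proof.
elim: s a => [|z s IH] a.
  move=> /itv_partition_nil -> ax xy /(lt_le_trans xy) /(le_lt_trans ax).
  by rewrite ltxx.
move=> abs ax xy yb zs; have [zx|xz] := leP z x.
  have [|i si [? ?]] := IH z (itv_partition_cons abs) zx xy yb.
    by move=> w ws; apply: zs; rewrite inE ws orbT.
  by exists i.+1.
exists 0%N => //; split => //=.
by have := zs z (mem_head _ _); rewrite xz /= -leNgt.
Qed.

(** Nodes increase strictly, so none lies inside a cell, whereas a point of [F] inside a cell would
    lie in []a, b[] and hence be a node. *)
Lemma itv_partition_avoid a b s F i : itv_partition a b s ->
  (forall z, z \in F -> a < z < b -> z \in s) -> (i < size s)%N ->
  [/\ a <= nth b (a :: s) i, nth b (a :: s) i < nth b s i, nth b s i <= b &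
   forall z, z \in F -> ~~ (nth b (a :: s) i < z < nth b s i)].
Proof.
elim: s a i => [//|y s IH] a i abs Fs si.
have [/= /andP[ay pys] /eqP lb] := abs.
have ys : itv_partition y b s by exact: itv_partition_cons abs.
have yb : y <= b.
  rewrite -lb; have := order_path_min lt_trans pys.
  case: (lastP s) => [//|s' w] /allP ys'.
  by rewrite last_rcons ltW// ys'// mem_rcons mem_head.
case: i si => [_|i si] /=.
  split => // z zF; apply/negP => /andP[az zy].
  have := Fs z zF; rewrite az (lt_le_trans zy yb) => /(_ isT).
  rewrite inE lt_eqF//= => /(allP (order_path_min lt_trans pys)).
  by rewrite ltNge (ltW zy).
have [|yi ? ? ?] := IH y i ys _ si.
  move=> z zF /andP[yz zb]; have := Fs z zF.
  rewrite (lt_trans ay yz) zb => /(_ isT).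
  by rewrite inE gt_eqF.
by split => //; rewrite (le_trans (ltW ay)).
Qed.

Lemma itv_partition_of_seq a b F : a < b ->
  exists2 s, itv_partition a b s & forall z, z \in F -> a < z < b -> z \in s.
Proof.
move=> ab; pose s := sort <=%R (undup [seq z <- F | a < z < b]).
have sP z : z \in s = (z \in F) && (a < z < b).
  by rewrite mem_sort mem_undup mem_filter andbC.
(* An [itv_partition] lists its right endpoint but not its left one. *)
exists (rcons s b); last first.
  by move=> z zF zab; rewrite mem_rcons inE sP zF zab orbT.
split; last by rewrite last_rcons.
rewrite rcons_path; apply/andP; split.
  rewrite lt_path_sortedE sort_lt_sorted undup_uniq andbT.
  by apply/allP => z; rewrite sP => /and3P[].
have := mem_last a s; rewrite inE => /orP[/eqP ->//|].
by rewrite sP => /and3P[].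
Qed.

(** An interval avoiding the nodes lies in one cell, whose extension restricts to it. Conversely, a
    subdivision through [F] has cells avoiding [F]. *)
Lemma piecewise_C_onP a b u : a <= b ->
  piecewise_C_on nu a b u <-> exists F, pieces F a b u.
Proof.
move=> ab; split=> [[s abs us]|[F Fu]].
  exists s => x y ax xy yb /(itv_partition_cover abs ax xy yb)[i si [xi yi]].
  have [g Cg ug] := us i si; exists g.
    apply: C_onS Cg => z /=; rewrite !in_itv /= => /andP[xz zy].
    by rewrite (le_trans xi xz) (le_trans zy yi).
  move=> z; rewrite in_itv /= => /andP[xz zy]; apply: ug.
  by rewrite in_itv /= (le_lt_trans xi xz) (lt_le_trans zy yi).
(* When [a = b], the empty subdivision leaves no cell to check. *)
move: ab; rewrite le_eqVlt => /predU1P[->|ab]; first by exists [::].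
have [s abs Fs] := itv_partition_of_seq F ab.
exists s => // i /(itv_partition_avoid abs Fs)[ax xy yb xFy].
exact: Fu.
Qed.

Lemma pieces0 F a b : pieces F a b (fun=> 0).
Proof. by move=> x y _ _ _ _; exists (fun=> 0) => //; exact: C_on0. Qed.

Lemma piecesD F G a b u v :
  pieces F a b u -> pieces G a b v -> pieces (F ++ G) a b (fun t => u t + v t).
Proof.
move=> Fu Gv x y ax xy yb FG.
have [|f Cf uf] := Fu x y ax xy yb.
  by move=> z zF; apply: FG; rewrite mem_cat zF.
have [|g Cg vg] := Gv x y ax xy yb.
  by move=> z zG; apply: FG; rewrite mem_cat zG orbT.
exists (fun t => f t + g t); first exact: C_onD.
by move=> t txy; rewrite uf // vg.
Qed.

Lemma pieces_mulmx F a b (M : 'M[R[i]]_d) u :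
  pieces F a b u -> pieces F a b (fun t => M *m u t).
Proof.
move=> Fu x y ax xy yb Fxy; have [g Cg ug] := Fu x y ax xy yb Fxy.
exists (fun t => M *m g t); first exact: C_on_mulmx.
by move=> t txy; rewrite ug.
Qed.

Lemma pieces_translate F a b h u :
  pieces F (a + h) (b + h) u ->
  pieces [seq z - h | z <- F] a b (fun t => u (t + h)).
Proof.
move=> Fu x y ax xy yb Fxy.
have [|||z zF|g Cg ug] := Fu (x + h) (y + h); rewrite ?lerD2r ?ltrD2r//.
  by rewrite -ltrBrDr -(ltrBlDr z h y); apply: Fxy; exact: map_f.
exists (fun t => g (t + h)).
  apply: C_onS (@C_on_translate _ _ _ _ _ h Cg) => t /=.
  by rewrite !in_itv /= !lerD2r.
move=> t; rewrite in_itv /= => txy; apply: ug.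
by rewrite in_itv /= !ltrD2r.
Qed.

Lemma piecewise_C0 : piecewise_C nu (fun=> 0 : 'cV[R[i]]_d).
Proof.
move=> a b ab; apply/(piecewise_C_onP _ (ltW ab)).
by exists [::]; exact: pieces0.
Qed.

Lemma piecewise_CD u v : piecewise_C nu u -> piecewise_C nu v ->
  piecewise_C nu (fun t => u t + v t).
Proof.
move=> pu pv a b ab; apply/(piecewise_C_onP _ (ltW ab)).
have [F Fu] := (piecewise_C_onP _ (ltW ab)).1 (pu _ _ ab).
have [G Gv] := (piecewise_C_onP _ (ltW ab)).1 (pv _ _ ab).
by exists (F ++ G); exact: piecesD.
Qed.

Lemma piecewise_C_mulmx_translate (M : 'M[R[i]]_d) h u : piecewise_C nu u ->
  piecewise_C nu (fun t => M *m u (t + h)).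
Proof.
move=> pu a b ab; apply/(piecewise_C_onP _ (ltW ab)).
have abh : a + h < b + h by rewrite ltrD2r.
have [F Fu] := (piecewise_C_onP _ (ltW abh)).1 (pu _ _ abh).
by exists [seq z - h | z <- F]; apply: pieces_mulmx; exact: pieces_translate.
Qed.

(** [piecewise_C] speaks only of segments with [a < b]; the degenerate one is covered by the empty
    subdivision. *)
Lemma piecewise_C_restrict a b u : a <= b -> piecewise_C nu u ->
  piecewise_C_on nu a b u.
Proof.
rewrite le_eqVlt => /predU1P[<-|ab] pu; last exact: pu.
by exists [::].
Qed.

Lemma eq_piecewise_C_on a b u v : a <= b -> {in `[a, b], u =1 v} ->
  piecewise_C_on nu a b u -> piecewise_C_on nu a b v.
Proof.
move=> ab uv /(piecewise_C_onP _ ab)[F Fu]; apply/(piecewise_C_onP _ ab).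
exists F => x y ax xy yb Fxy; have [g Cg ug] := Fu x y ax xy yb Fxy.
exists g => // t txy; rewrite -ug// uv//.
move: txy; rewrite !in_itv /= => /andP[xt ty].
by rewrite (le_trans ax (ltW xt)) (le_trans (ltW ty) yb).
Qed.

End pieces.

(** * Finite combinations of translates *)

Lemma measurable_lebesgueT_itv (R : realType) (i : interval R) :
  measurable ([set` i] : set (lebesgueT R)).
Proof. by apply: sub_caratheodory; exact: measurable_itv. Qed.

Section comb.
Variables (R : realType) (d : nat).
Implicit Types (L K : seq ('M[R[i]]_d * R)) (u f w : R -> 'cV[R[i]]_d).

Definition comb L u : R -> 'cV[R[i]]_d :=
  fun t => \sum_(p <- L) p.1 *m u (t + p.2).

Lemma comb_cons p L u :
  comb (p :: L) u = fun t => p.1 *m u (t + p.2) + comb L u t.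
Proof. by apply/funext => t; rewrite /comb big_cons. Qed.

(** Applied both to [box] and to its left inverse, for each of the three regularity classes. *)
Lemma comb_closed (P : (R -> 'cV[R[i]]_d) -> Prop) L u :
  P (fun=> 0) -> (forall v w, P v -> P w -> P (fun t => v t + w t)) ->
  (forall (M : 'M[R[i]]_d) h v, P v -> P (fun t => M *m v (t + h))) ->
  P u -> P (comb L u).
Proof.
move=> P0 PD PM Pu; elim: L => [|p L IH].
  by rewrite /comb; under eq_fun do rewrite big_nil.
by rewrite comb_cons; apply: PD => //; exact: PM.
Qed.

(* Solving the equation [w = comb ((C, h0) :: L) f] for the term [C *m f]
   expresses [f s] through [w] and values of [f] at points where [sgm * _] is
   smaller by at least [eps]; hence the induction on [n]. *)
Lemma comb_left_inverse (sgm m eps h0 : R) (C : 'M[R[i]]_d) L n :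
  C \in unitmx ->
  (forall p, p \in L -> sgm * (p.2 - h0) <= - eps) ->
  exists K, forall f, (forall s, sgm * s < m -> f s = 0) ->
    forall s, sgm * s < m + n%:R * eps ->
      f s = comb K (comb ((C, h0) :: L) f) s.
Proof.
move=> uC Leps; elim: n => [|n [K IH]].
  (* With no step made, [f] is zero on the region, as is the empty combination. *)
  exists [::] => f f0 s; rewrite mul0r addr0 => /f0 ->.
  by rewrite /comb big_nil.
(* The equation at [s - h0] gives [f s] as [invmx C] times [w (s - h0)] minus the sum of the
   [q.1 *m f (s + (q.2 - h0))]; each of these values of [f] is then replaced by its [K]-combination
   of [w]. *)
exists ((invmx C, - h0) ::
  [seq (- invmx C *m q.1 *m p.1, p.2 + (q.2 - h0)) | q <- L, p <- K]).
move=> f f0 s sn; rewrite {1}/comb big_cons big_allpairs_dep /=.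
(* The induction hypothesis applies at [s + (q.2 - h0)], where [sgm * _] has dropped by at least
   [eps]. *)
have E q : q \in L -> \sum_(p <- K)
    (- invmx C *m q.1 *m p.1) *m
      comb ((C, h0) :: L) f (s + (p.2 + (q.2 - h0))) =
    - invmx C *m (q.1 *m f (s + (q.2 - h0))).
  move=> qL; rewrite (IH f f0); last first.
    rewrite mulrDr; move: sn (Leps _ qL); rewrite -natr1 mulrDl mul1r; lra.
  rewrite {2}/comb !mulmx_sumr; apply: eq_bigr => p _.
  by rewrite !mulmxA addrAC -addrA.
rewrite (eq_big_seq _ E) -mulmx_sumr mulNmx -mulmxBr comb_cons /= subrK.
(* The subtracted sum is the tail of the equation at [s - h0], so only [invmx C *m (C *m f s)]
   survives. *)
rewrite [X in _ - X](_ : _ = comb L f (s - h0)) ?addrK ?mulKmx//.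
by rewrite /comb; apply: eq_bigr => q _; rewrite -addrA [- h0 + _]addrC.
Qed.

Lemma comb_continuous L u t :
  (forall p, p \in L -> {for t + p.2, continuous u}) ->
  {for t, continuous (comb L u)}.
Proof.
elim: L => [|p L IH] cu.
  have -> : comb [::] u = (fun=> 0) by apply/funext => x; rewrite /comb big_nil.
  exact: cvg_cst.
rewrite comb_cons; apply: cvg_vecD.
  apply: cvg_vec_mulmx.
  apply: (@continuous_comp _ _ _ (fun x => x + p.2) u t).
    by apply: cvgD => //; exact: cvg_cst.
  by apply: cu; rewrite mem_head.
by apply: IH => q qL; apply: cu; rewrite inE qL orbT.
Qed.

End comb.

(** * Cutoff to a segment *)

Section cutoff.
Variables (R : realType) (d : nat) (a b : R).
Implicit Types (u v : R -> 'cV[R[i]]_d).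

Definition cutoff u : R -> 'cV[R[i]]_d :=
  fun t => \1_(`[a, b]%classic : set R) t *: u t.

Lemma cutoff_in u t : t \in `[a, b] -> cutoff u t = u t.
Proof. by move=> tab; rewrite /cutoff indicE mem_set// scale1r. Qed.

Lemma cutoff_out u t : t \notin `[a, b] -> cutoff u t = 0.
Proof.
by move=> /negP tab; rewrite /cutoff indicE memNset// scale0r.
Qed.

(** A general [g] treats [Re] and [Im] at once; the right side is a restriction extended by zero,
    for which measurability and integrability are known to transfer. *)
Let cutoff_part (g : R[i] -> R) u i : g 0 = 0 ->
  (fun t => g (cutoff u t i 0)) = (fun t => g (u t i 0)) \_ `[a, b].
Proof.
move=> g0; apply/funext => t; rewrite patchE.
case: ifPn => [/set_mem tab|/negP tab]; first by rewrite cutoff_in.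
by rewrite cutoff_out ?mxE//; apply/negP => tab'; apply: tab; rewrite inE.
Qed.

Let mab : measurable (`[a, b]%classic : set (lebesgueT R)) :=
  measurable_lebesgueT_itv _.

Lemma vmeasurable_cutoff u :
  vmeasurable `[a, b]%classic u <-> vmeasurable setT (cutoff u).
Proof.
have E (g : R[i] -> R) i : g 0 = 0 ->
    measurable_fun (`[a, b]%classic : set (lebesgueT R))
      (fun t => g (u t i 0)) <->
    measurable_fun (setT : set (lebesgueT R)) (fun t => g (cutoff u t i 0)).
  by move=> g0; rewrite (cutoff_part u i g0); exact: measurable_restrictT.
by split => mu i; have [? ?] := mu i; split; apply/E.
Qed.

Lemma vintegrable_cutoff u :
  vintegrable `[a, b]%classic u <-> vintegrable setT (cutoff u).
Proof.
have E (g : R[i] -> R) i : g 0 = 0 ->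
    (@completed_lebesgue_measure R).-integrable `[a, b]
      (fun t => (g (u t i 0))%:E) <->
    (@completed_lebesgue_measure R).-integrable setT
      (fun t => (g (cutoff u t i 0))%:E).
  move=> g0; have -> : (fun t => (g (cutoff u t i 0))%:E) =
      (fun t => (g (u t i 0))%:E) \_ `[a, b].
    have := cutoff_part u i g0 => /(congr1 (comp EFin)).
    by rewrite -restrict_EFin.
  exact: integrable_mkcond.
by split => iu i; have [? ?] := iu i; split; apply/E.
Qed.

Lemma vmeasurable_itv u v : {in `[a, b], u =1 v} ->
  vmeasurable setT v -> vmeasurable `[a, b]%classic u.
Proof.
move=> uv mv i; have [mRe mIm] := mv i; split.
  apply: (eq_measurable_fun (fun t : lebesgueT R => complex.Re (v t i 0))).
    by move=> t /set_mem tab; rewrite uv.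
  exact: (measurable_funS measurableT (@subsetT _ _) mRe).
apply: (eq_measurable_fun (fun t : lebesgueT R => complex.Im (v t i 0))).
  by move=> t /set_mem tab; rewrite uv.
exact: (measurable_funS measurableT (@subsetT _ _) mIm).
Qed.

Lemma vintegrable_itv u v : {in `[a, b], u =1 v} ->
  vintegrable setT v -> vintegrable `[a, b]%classic u.
Proof.
move=> uv iv i; have [iRe iIm] := iv i; split.
  apply: (eq_integrable mab (fun t => (complex.Re (v t i 0))%:E)).
    by move=> t /set_mem tab; rewrite uv.
  exact: (integrableS measurableT mab (@subsetT _ _) iRe).
apply: (eq_integrable mab (fun t => (complex.Im (v t i 0))%:E)).
  by move=> t /set_mem tab; rewrite uv.
exact: (integrableS measurableT mab (@subsetT _ _) iIm).
Qed.

(** With [a] and [b] added to the exceptional points, each interval []x, y[] lies either inside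
    [[a, b]], where [u] is unchanged, or outside, where the cutoff is zero. *)
Lemma piecewise_C_cutoff nu u : a <= b ->
  piecewise_C_on nu a b u -> piecewise_C nu (cutoff u).
Proof.
move=> ab /(piecewise_C_onP _ _ ab)[F Fu] x0 y0 xy0.
apply/(piecewise_C_onP _ _ (ltW xy0)); exists [:: a, b & F] => x y _ xy _ Fxy.
have out : (forall t, t \in `]x, y[ -> t \notin `[a, b]) ->
    exists2 g, C_on `[x, y]%classic nu g & {in `]x, y[, cutoff u =1 g}.
  move=> xyab; exists (fun=> 0); first exact: C_on0.
  by move=> t /xyab; exact: cutoff_out.
have [ya|ay] := leP y a.
  apply: out => t; rewrite !in_itv /= => /andP[xt ty].
  by rewrite leNgt (lt_le_trans ty ya).
have [bx|xb] := leP b x.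
  apply: out => t; rewrite !in_itv /= => /andP[xt ty].
  by rewrite andbC leNgt (le_lt_trans bx xt).
have ax : a <= x.
  by have := Fxy a (mem_head _ _); rewrite ay andbT -leNgt.
have yb : y <= b.
  by have := Fxy b; rewrite !inE eqxx orbT xb /= -leNgt; apply.
have [z zF|g Cg ug] := Fu x y ax xy yb.
  by apply: Fxy; rewrite !inE zF !orbT.
exists g => // t txy; rewrite cutoff_in ?ug//.
move: txy; rewrite !in_itv /= => /andP[xt ty].
by rewrite (le_trans ax (ltW xt)) (le_trans (ltW ty) yb).
Qed.

(** Away from the endpoints, the cutoff is locally equal to [u] or to zero. *)
Lemma cutoff_continuous u t : t != a -> t != b ->
  {for t, continuous u} -> {for t, continuous (cutoff u)}.
Proof.
move=> ta tb cu.
have [tab|tab] := boolP (t \in `[a, b]).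
  have tab' : t \in `]a, b[.
    move: tab; rewrite !in_itv /= !le_eqVlt.
    by rewrite (eq_sym a) (negbTE ta) (negbTE tb).
  have E : \forall s \near t, u s = cutoff u s.
    have := near_in_itvoo tab'; apply: filterS => s sab.
    by rewrite cutoff_in//; exact: subset_itv_oo_cc.
  change (cutoff u @ t --> cutoff u t); rewrite cutoff_in//.
  exact: (cvg_trans (near_eq_cvg E) cu).
have E : \forall s \near t, (fun=> 0 : 'cV[R[i]]_d) s = cutoff u s.
  move: tab; rewrite in_itv /= negb_and -!ltNge => /orP[ta'|bt].
    have : t \in `]-oo, a[ by rewrite in_itv.
    move=> /near_in_itvNyo; apply: filterS => s; rewrite in_itv /= => sa.
    by rewrite cutoff_out// in_itv /= negb_and -ltNge sa.
  have : t \in `]b, +oo[ by rewrite in_itv /= bt.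
  move=> /near_in_itvoy; apply: filterS => s; rewrite in_itv /= andbT => bs.
  by rewrite cutoff_out// in_itv /= negb_and -!ltNge bs orbT.
change (cutoff u @ t --> cutoff u t); rewrite (cutoff_out u tab).
apply: cvg_trans (near_eq_cvg E) _.
exact: cvg_cst.
Qed.

End cutoff.

(** * The operator [box] *)

Section box.
Variables (R : realType) (d : nat) (t0 tf eps : R) (c : int -> 'M[R[i]]_d).
Variable N : nat.
Hypothesis (hN : is_order c N).
Implicit Types (u : R -> 'cV[R[i]]_d).

(** An explicit list, both to turn the sum over all integers into a finite one and to count
    discontinuities. *)
Definition shifts : seq int := [seq n%:Z - N%:Z | n <- iota 0 (2 * N + 1)].

Lemma shifts_uniq : uniq shifts.
Proof. by rewrite map_inj_uniq ?iota_uniq// => m n /addIr []. Qed.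

Lemma mem_shifts (k : int) : (k \in shifts) = (- N%:Z <= k <= N%:Z).
Proof.
apply/mapP/idP => [[n + ->]|kN].
  by rewrite mem_iota => /andP[_ nN]; lia.
by exists (absz (k + N%:Z)); [rewrite mem_iota; lia|lia].
Qed.

Lemma order_support k : k \notin shifts -> c k = 0.
Proof.
rewrite mem_shifts; apply: contraNeq => ck.
have := hN.2 k (or_introl ck).
have := hN.2 (- k); rewrite opprK => /(_ (or_intror ck)); lia.
Qed.

Definition box_coefs (r : seq int) : seq ('M[R[i]]_d * R) :=
  [seq (c k, k%:~R * eps) | k <- r].

Lemma comb_box_coefs r u t :
  comb (box_coefs r) u t = \sum_(k <- r) c k *m u (t + k%:~R * eps).
Proof. by rewrite /comb big_map. Qed.

Lemma box_comb u : box t0 tf eps c u = comb (box_coefs shifts) (cutoff t0 tf u).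
Proof.
apply/funext => t; rewrite comb_box_coefs /box.
rewrite (fsbigE shifts) ?shifts_uniq//; last first.
  by move=> k _ /order_support ->; rewrite mul0mx scaler0.
by apply: eq_big => [k|k _]; [rewrite mem_set|rewrite /cutoff scalemxAr].
Qed.

(** Brings the term to be solved for to the head, the shape that [comb_left_inverse] inverts. *)
Lemma box_comb_split u k : k \in shifts -> box t0 tf eps c u =
  comb ((c k, k%:~R * eps) :: box_coefs [seq j <- shifts | j != k])
    (cutoff t0 tf u).
Proof.
move=> ks; rewrite box_comb; apply/funext => t.
by rewrite comb_cons !comb_box_coefs big_filter (bigD1_seq k) ?shifts_uniq.
Qed.

(** If [c N] is invertible, solve from [t0] rightwards ([sgm = 1]); if [c (- N)] is, solve from [tf]
    leftwards ([sgm = -1]). [K] is chosen before [u]. *)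
Lemma box_left_inverse : 0 < eps ->
  c N%:Z \in unitmx \/ c (- N%:Z) \in unitmx ->
  exists K, forall u, {in `[t0, tf], u =1 comb K (box t0 tf eps c u)}.
Proof.
(* Enough steps of length [eps] to go strictly past the other end. *)
move=> eps0; pose n := (Num.truncn ((tf - t0) / eps)).+1.
have tfn : tf < t0 + n%:R * eps.
  by rewrite -ltrBlDl -ltr_pdivrMr// truncnS_gt.
case=> uc.
  have [|K invK] := @comb_left_inverse _ _ 1 t0 eps (N%:Z%:~R * eps) (c N%:Z)
      (box_coefs [seq j <- shifts | j != N%:Z]) n uc.
    (* Any other index is at most [N - 1], which gives the gap [eps]. *)
    move=> _ /mapP[j + ->]; rewrite mem_filter mem_shifts /= => jN.
    have jN1 : (j + 1)%:~R <= N%:Z%:~R :> R by rewrite ler_int; lia.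
    by move: jN1; rewrite intrD => jN1; nra.
  exists K => u s sab.
  rewrite (@box_comb_split _ N%:Z) ?mem_shifts; last by lia.
  rewrite -invK ?cutoff_in// => [x|].
    by rewrite mul1r => xt; rewrite cutoff_out// in_itv /= negb_and -ltNge xt.
  move: sab; rewrite mul1r in_itv /= => /andP[_ /le_lt_trans].
  by apply.
have [|K invK] := @comb_left_inverse _ _ (-1) (- tf) eps
    ((- N%:Z)%:~R * eps) (c (- N%:Z))
    (box_coefs [seq j <- shifts | j != - N%:Z]) n uc.
  move=> _ /mapP[j + ->]; rewrite mem_filter mem_shifts /= => jN.
  have jN1 : (- N%:Z + 1)%:~R <= j%:~R :> R by rewrite ler_int; lia.
  by move: jN1; rewrite intrD => jN1; nra.
exists K => u s sab.
rewrite (@box_comb_split _ (- N%:Z)) ?mem_shifts; last by lia.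
rewrite -invK ?cutoff_in// => [x|].
  rewrite mulN1r ltrN2 => xt.
  by rewrite cutoff_out// in_itv /= negb_and -!ltNge xt orbT.
by move: sab; rewrite in_itv /= mulN1r => /andP[ts _]; lra.
Qed.

(** The segment is closed, so it suffices that [box u] is zero off it: there every [t + k eps] with
    [|k| <= N] misses [[t0, tf]]. *)
Lemma Supp_box u : 0 < eps ->
  Supp (box t0 tf eps c u) `<=` `[t0 - N%:R * eps, tf + N%:R * eps]%classic.
Proof.
move=> eps0; rewrite [X in _ `<=` X](closure_id _).1; last exact: itv_closed.
apply: closureS => t /eqP ut; apply: contrapT => tN; apply: ut.
rewrite box_comb comb_box_coefs big_seq big1// => k; rewrite mem_shifts => kN.
rewrite cutoff_out ?mulmx0//; apply: contra_notN tN => /=.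
rewrite !in_itv /= => /andP[tk kt].
have k1 : - N%:R <= k%:~R :> R.
  by rewrite -[N%:R]/(N%:Z%:~R) -intrN ler_int; lia.
have k2 : k%:~R <= N%:R :> R by rewrite -[N%:R]/(N%:Z%:~R) ler_int; lia.
by apply/andP; split; nra.
Qed.

Lemma compact_Supp_box u : 0 < eps -> compact (Supp (box t0 tf eps c u)).
Proof.
move=> eps0; apply: subclosed_compact (Supp_box eps0).
  exact: closed_closure.
exact: segment_compact.
Qed.

Lemma piecewise_C_box nu u : t0 <= tf -> piecewise_C_on nu t0 tf u ->
  piecewise_C nu (box t0 tf eps c u).
Proof.
move=> t0f pu; rewrite box_comb.
apply: (comb_closed (P := piecewise_C nu)); last exact: piecewise_C_cutoff.
- exact: piecewise_C0.
- exact: piecewise_CD.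
- exact: piecewise_C_mulmx_translate.
Qed.

(** If no [t + k eps] is an endpoint or a discontinuity of [u], every translate of the cutoff is
    continuous at [t]. *)
Lemma discontinuities_box u : discontinuities (box t0 tf eps c u) `<=`
  \bigcup_(k in [set` shifts])
    [set x - k%:~R * eps | x in [set t0; tf] `|` discontinuities u].
Proof.
move=> t; apply: contra_notP => tD; rewrite box_comb; apply: comb_continuous.
move=> _ /mapP[k ks ->] /=.
have tk x : x = t + k%:~R * eps ->
    x \in [set t0; tf] `|` discontinuities u -> False.
  move=> -> /set_mem xD; apply: tD; exists k => //.
  exists (t + k%:~R * eps) => //.
  by rewrite addrK.
apply: cutoff_continuous.
- by apply/eqP => /esym/tk; apply; rewrite inE; left; left.
- by apply/eqP => /esym/tk; apply; rewrite inE; left; right.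
- by apply: contrapT => /= dt; apply: (tk _ erefl); rewrite inE; right.
Qed.

(** Each of the [2 * N + 1] shifts contributes at most [p + 2] points: the two endpoints and the
    discontinuities of [u]. *)
Lemma card_discontinuities_box p u : discontinuities u #= `I_p ->
  discontinuities (box t0 tf eps c u) #<= `I_((4 * N + 2) + (2 * N + 1) * p)%N.
Proof.
move=> dp; have /finite_fsetP[D DE] : finite_set (discontinuities u).
  by apply/finite_set_leP; exists p; move/card_eqPle : dp => [].
have Dp : size (finmap.enum_fset D) = p by apply/card_eq_fsetP; rewrite -DE.
pose s := [seq x - k%:~R * eps |
  k <- shifts, x <- [:: t0, tf & finmap.enum_fset D]].
have sz : size s = (4 * N + 2 + (2 * N + 1) * p)%N.
  by rewrite size_allpairs /= size_map size_iota Dp; lia.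
rewrite -sz; apply: card_le_trans (_ : _ #<= [set` s]) _.
  apply: subset_card_le => t /discontinuities_box[k /= ks [x xD <-]] /=.
  apply: allpairs_f => //; rewrite !inE.
  case: xD => [[->|->]|]; rewrite ?eqxx ?orbT//.
  by rewrite DE /= => ->; rewrite !orbT.
(* The list may have repetitions, so its size only bounds the cardinality. *)
have -> : [set` s] = nth 0 s @` `I_(size s).
  apply/seteqP; split=> [x /= /(nthP 0)[i si <-]|_ [i /= si <-]].
    by exists i.
  exact: mem_nth.
exact: card_image_le.
Qed.

End box.

Theorem theorem2p1 (R : realType) (d : nat) (t0 tf eps : R)
    (c : int -> 'M[R[i]]_d) (N : nat)
    (hd : (1 <= d)%N) (ht : t0 <= tf) (heps : 0 < eps)
    (hc : almost_zero c) (hN : is_order c N) :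
  [/\ (forall (nu : option nat) (u : R -> 'cV[R[i]]_d),
         piecewise_C nu u ->
         [/\ piecewise_C nu (box t0 tf eps c u),
             compact (Supp (box t0 tf eps c u)) &
             Supp (box t0 tf eps c u) `<=`
               `[t0 - N%:R * eps, tf + N%:R * eps]%classic]),
      (forall (p : nat) (u : R -> 'cV[R[i]]_d),
         discontinuities u #= `I_p ->
         discontinuities (box t0 tf eps c u) #<=
           `I_((4 * N + 2) + (2 * N + 1) * p)%N),
      (c N%:Z \in unitmx \/ c (- N%:Z) \in unitmx ->
         [set u : R -> 'cV[R[i]]_d | box t0 tf eps c u = (fun=> 0)] =
         [set u : R -> 'cV[R[i]]_d | forall t, t \in `[t0, tf] -> u t = 0]) &
      (c N%:Z \in unitmx \/ c (- N%:Z) \in unitmx ->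
         forall u : R -> 'cV[R[i]]_d,
         [/\ (vmeasurable setT (box t0 tf eps c u) <->
                vmeasurable `[t0, tf]%classic u),
             (vintegrable setT (box t0 tf eps c u) <->
                vintegrable `[t0, tf]%classic u) &
             (forall nu : option nat,
                piecewise_C nu (box t0 tf eps c u) <->
                piecewise_C_on nu t0 tf u)])].
Proof.
have inv := box_left_inverse t0 tf hN heps.
split.
- move=> nu u pu; split.
  + have := piecewise_C_restrict ht pu.
    exact: (@piecewise_C_box _ _ _ _ _ _ _ hN).
  + exact: (@compact_Supp_box _ _ _ _ _ _ _ hN).
  + exact: (@Supp_box _ _ _ _ _ _ _ hN).
- by move=> p u; exact: (@card_discontinuities_box _ _ _ _ _ _ _ hN).
(* If [box u] is zero, so is [comb K (box u)], which is [u] on the segment; conversely, the cutoff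
   of [u] is zero. *)
- move=> /inv[K invK]; apply/seteqP; split=> u /= u0.
    move=> t tab; rewrite (invK u t tab) u0.
    by rewrite /comb big1// => q _; rewrite mulmx0.
  rewrite (box_comb t0 tf eps hN).
  have -> : cutoff t0 tf u = (fun=> 0).
    apply/funext => t; have [tab|tab] := boolP (t \in `[t0, tf]).
      by rewrite cutoff_in// u0.
    exact: cutoff_out.
  by apply/funext => t; rewrite /comb big1// => q _; rewrite mulmx0.
(* Regularity passes from [box u] to [comb K (box u)], hence to [u] on the segment; and from [u] to
   its cutoff, hence to [box u]. *)
- move=> /inv[K invK] u.
  split.
  + split=> [mb|/vmeasurable_cutoff mu].
      apply: (vmeasurable_itv (invK u)).
      exact: (comb_closed (P := vmeasurable setT) _ (@vmeasurable0 _ _)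
        (@vmeasurableD _ _) (@vmeasurable_mulmx_translate _ _) mb).
    rewrite (box_comb t0 tf eps hN).
    exact: (comb_closed (P := vmeasurable setT) _ (@vmeasurable0 _ _)
      (@vmeasurableD _ _) (@vmeasurable_mulmx_translate _ _) mu).
  + split=> [ib|/vintegrable_cutoff iu].
      apply: (vintegrable_itv (invK u)).
      exact: (comb_closed (P := vintegrable setT) _ (@vintegrable0 _ _)
        (@vintegrableD _ _) (@vintegrable_mulmx_translate _ _) ib).
    rewrite (box_comb t0 tf eps hN).
    exact: (comb_closed (P := vintegrable setT) _ (@vintegrable0 _ _)
      (@vintegrableD _ _) (@vintegrable_mulmx_translate _ _) iu).
  + move=> nu; split=> [pb|]; last exact: (@piecewise_C_box _ _ _ _ _ _ _ hN).
    apply: (eq_piecewise_C_on ht (fun t tab => esym (invK u t tab))).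
    apply: (piecewise_C_restrict ht).
    exact: (comb_closed (P := piecewise_C nu) _ (@piecewise_C0 _ _ nu)
      (@piecewise_CD _ _ nu) (@piecewise_C_mulmx_translate _ _ nu) pb).
Qed.
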